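(* Let $T \in \mathbf{B}(\mathcal H)$ and let $\mathcal M$ be a nonzero subspace of $\mathcal H$. Assume there exist $X$ and $Y$, dense subsets of $\mathcal M$, and an increasing sequence of positive integers $\{n_k\}_{k\in\mathbb N}$ such that (i) $T^{n_k} x \to 0$ as $k\to\infty$ for all $x \in X$; (ii) for each $y \in Y$, there exists a sequence $\{x_k\}$ in $\mathcal M$ such that $x_k \to 0$ and $T^{n_k} x_k \to y$ as $k \to \infty$; (iii) $\mathcal M$ is an invariant subspace for $T^{n_k}$ for all $k \in \mathbb N$ (i.e. $T^{n_k}(\mathcal M)\subseteq \mathcal M$). Then $T$ is subspace-transitive with respect to $\mathcal M$, and hence $T$ is subspace-hypercyclic for $\mathcal M$.
   Context: $\mathcal H$ is a separable Hilbert space over $\mathbb C$; $\mathbf{B}(\mathcal H)$ is the set of bounded linear operators on $\mathcal H$; ''subspace'' always means topologically closed linear subspace; $\mathbb N_0 = \mathbb N\cup\{0\}$. For $x\in\mathcal H$, $\operatorname{Orb}(T,x) := \{T^n x : n\in\mathbb N_0\}$. $T$ is subspace-hypercyclic for a nonzero subspace $\mathcal M$ if there exists $x\in\mathcal H$ such that $\operatorname{Orb}(T,x)\cap\mathcal M$ is dense in $\mathcal M$. $T$ is subspace-transitive with respect to a nonzero subspace $\mathcal M$ if for all nonempty relatively open sets $U\subseteq\mathcal M$ and $V\subseteq\mathcal M$ there exists $n\in\mathbb N_0$ such that $T^{-n}(U)\cap V$ contains a relatively open nonempty subset of $\mathcal M$, where $T^{-n}(U)=\{x\in\mathcal H: T^n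 x\in U\}$. *)

(* Defs.v *)
From HB Require Import structures.
From mathcomp Require Import all_boot all_order all_algebra.
From mathcomp Require Import complex.
From mathcomp Require Import all_classical all_reals all_analysis.

Set Implicit Arguments.
Unset Strict Implicit.
Unset Printing Implicit Defensive.

Import Order.TTheory GRing.Theory Num.Theory.
Import numFieldNormedType.Exports.

Local Open Scope classical_set_scope.
Local Open Scope ring_scope.
Local Open Scope complex_scope.

(* Complex Hilbert spaces: the scalars are C = R[i], where R is the field of
   real numbers; the inner product is linear in its first argument and
   conjugate-linear in the second. *)
HB.mixin Record CompleteNormedModule_isHilbert (R : realType) H
    of CompleteNormedModule R[i] H := {
  inner : {dot H for (@Num.conj R[i])} ;
  inner_normE : forall x : H, `|x| ^+ 2 = inner x x
}.

#[short(type="hilbertType")]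
HB.structure Definition Hilbert (R : realType) :=
  {H of CompleteNormedModule R[i] H & CompleteNormedModule_isHilbert R H}.

Definition separable (X : topologicalType) : Prop :=
  exists2 D : set X, countable D & dense D.

Section SubspaceDynamics.
Context {R : realType} {H : hilbertType R}.
Implicit Types (T : H -> H) (M A U V : set H) (x : H).

Definition bounded_operator T : Prop :=
  exists c : R, forall x, `|T x| <= c%:C * `|x|.

Definition closed_subspace M : Prop := closed M /\ submod_closed [in M].

Definition rel_open M U : Prop := exists2 O : set H, open O & U = O `&` M.

Definition dense_in M A : Prop := A `<=` M /\ M `<=` closure A.

Definition Orb T x : set H := range (fun n : nat => iter n T x).

Definition subspace_hypercyclic T M : Prop :=
  exists x : H, dense_in M (Orb T x `&` M).

Definition subspace_transitive T M : Prop :=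
  forall U V : set H,
    rel_open M U -> U !=set0 -> rel_open M V -> V !=set0 ->
    exists (n : nat) (W : set H),
      [/\ rel_open M W, W !=set0 & W `<=` (iter n T @^-1` U) `&` V].

End SubspaceDynamics.

(* Main.v *)
Require Import Defs.
From HB Require Import structures.
From mathcomp Require Import all_boot all_order all_algebra.
From mathcomp Require Import complex.
From mathcomp Require Import all_classical all_reals all_analysis.

Set Implicit Arguments.
Unset Strict Implicit.
Unset Printing Implicit Defensive.

Import Order.TTheory GRing.Theory Num.Theory.
Import numFieldNormedType.Exports.

Local Open Scope classical_set_scope.
Local Open Scope ring_scope.

(* Transitivity is obtained by perturbing a point of X near V by small vectors
   x_k with T^(n_k) x_k close to a point of Y near U.  Transitivity gives
   hypercyclicity by a Baire category argument in M: for each B in a countable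
   base of M, the points of M whose orbit meets B contain a dense relatively
   open set. *)

(** In the order of [R[i]], [0 < e] forces the imaginary part of [e] to vanish, so the Archimedean
    property of [R] applies to its real part. *)
Lemma complex_harmonic_lt (R : realType) (e : R[i]) :
  0 < e -> exists n, n.+1%:R^-1 < e.
Proof.
move=> e0; move: (e0); rewrite ltcE => /andP[/eqP Im0 /= Re0].
exists (Num.truncn (complex.Re e)^-1); rewrite -[ltRHS]invrK ltf_pV2 ?posrE ?invr_gt0//.
have -> : e^-1 = ((complex.Re e)^-1)%:C%C.
  by rewrite fmorphV; congr (_^-1); case: e Im0 {e0 Re0} => a b /= ->.
by rewrite -(rmorph_nat (@real_complex R)) ltcR truncnS_gt.
Qed.

(** Having every [n] from [N] on lets the Baire construction shrink radii further at will. *)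
Lemma nbhs_harmonic_closed_ball (R : realType) (V : normedModType R[i])
    (x : V) (A : set V) : nbhs x A ->
  exists N, forall n, (N <= n)%N -> closed_ball x n.+1%:R^-1 `<=` A.
Proof.
move=> /nbhs_ballP[e /= e0 xeA].
have [N Ne] := @complex_harmonic_lt R (e / 2) (divr_gt0 e0 (ltr0Sn _ 1)).
exists N => n Nn; apply: subset_trans xeA.
apply: subset_trans (subset_closure_half e0).
apply: le_closed_ball; apply: le_trans (ltW Ne).
by rewrite lef_pV2 ?posrE// ler_nat.
Qed.

(** Baire's theorem relative to [M]: nested closed balls centred in [M], the successive ones
    catching [G 0], [G 1], and so on, have centres converging to the required point. *)
Lemma baire_closed_subset (R : realType) (V : completeNormedModType R[i])
    (M : set V) (G : (set V)^nat) : closed M -> M !=set0 ->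
  (forall j O, open O -> O `&` M !=set0 -> exists W : set V,
     [/\ open W, W `&` M !=set0 & W `&` M `<=` O `&` G j]) ->
  exists2 x, M x & forall j, G j x.
Proof.
move=> clM [c0 Mc0] denseG.
pose r n : R[i] := n.+1%:R^-1.
have r_gt0 n : 0 < r n by rewrite invr_gt0.
(* A pair [(c, n)] codes the ball of centre [c] and radius [r n]; [P (j, b) b'] says that [b'] is an
   admissible successor of [b] at stage [j]. The guard on the centre makes the choice function
   total. *)
pose P (p : nat * (V * nat)) (q : V * nat) := M p.2.1 ->
  [/\ M q.1, (p.1 <= q.2)%N,
      closed_ball q.1 (r q.2) `<=` ball p.2.1 (r p.2.2) &
      closed_ball q.1 (r q.2) `&` M `<=` G p.1].
have /choice[f fP] : forall p, exists q, P p q.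
  move=> [j [c n]]; have [Mc|nMc] := pselect (M c); last by exists (c, n).
  have [|W [oW [z [Wz Mz]] WG]] :=
      denseG j (ball c (r n)) (ball_open _ _).
    by exists c; split=> //; exact: ballxx.
  have : nbhs z (W `&` ball c (r n)).
    apply: open_nbhs_nbhs; split; first exact: openI oW (ball_open _ _).
    by split=> //; exact: (WG z _).1.
  move=> /nbhs_harmonic_closed_ball[N NW].
  (* Index at least [N] makes the ball fit; index at least [j] drives the radii to 0. *)
  exists (z, maxn j N) => _ /=; have NO := NW _ (leq_maxr j N); split=> //.
  - exact: leq_maxl.
  - by move=> y /NO[].
  - by move=> y [/NO[Wy _] My]; exact: (WG y _).2.
(* Indices shift by one: ball [n.+1] handles [G n], and the initial ball handles nothing. *)
pose fix s n := if n is p.+1 then f (p, s p) else (c0, 0%N).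
pose B n := closed_ball (s n).1 (r (s n).2).
have Ms n : M (s n).1 by elim: n => // n IHn; case: (fP (n, s n) IHn).
have sP n := fP (n, s n) (Ms n).
have Bc n : B n (s n).1 by apply/subset_closed_ball/ballxx.
have Bdec m n : (m <= n)%N -> B n `<=` B m.
  elim: n => [|n IHn]; first by rewrite leqn0 => /eqP ->.
  rewrite leq_eqVlt => /predU1P[-> //|/IHn]; apply: subset_trans.
  case: (sP n) => _ _ sub _; apply: subset_trans sub _.
  exact: subset_closed_ball.
have /cauchy_cvg/cvg_ex[l sl] : cauchy ((fun n => (s n).1) @ \oo).
  apply: cauchy_exP => e e0.
  have [N Ne] := complex_harmonic_lt (divr_gt0 e0 (ltr0Sn _ 1)).
  (* All later centres lie in ball [N.+1], whose radius is at most [r N], hence below [e / 2]. *)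
  exists (s N.+1).1; exists N.+1 => // m Nm /=.
  apply: subset_closure_half => //.
  apply: (@le_closed_ball _ _ _ (r (s N.+1).2)); last exact: Bdec Nm _ (Bc m).
  case: (sP N) => _ /= Ns _ _; apply: le_trans (ltW Ne).
  by rewrite lef_pV2 ?posrE// ler_nat.
have Ml : M l by apply: closed_cvg sl => //; exact: nearW.
exists l => // j; case: (sP j) => _ _ _; apply; split=> //.
apply: (closed_cvg (B j.+1) _ _ _ sl); first exact: closed_ball_closed.
by exists j.+1 => // n jn; exact: Bdec jn _ (Bc n).
Qed.

Lemma subspace_transitive_hypercyclic (R : realType) (H : hilbertType R)
    (T : H -> H) (M : set H) :
  separable H -> closed M -> M !=set0 ->
  subspace_transitive T M -> subspace_hypercyclic T M.
Proof.
move=> [D /countable_injP[f finj] dD] clM M0 trT.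
pose r n : R[i] := n.+1%:R^-1.
have r_gt0 n : 0 < r n by rewrite invr_gt0.
(* [pickle (f d, m)] numbers the ball of center d and radius 1/(m+1). *)
pose G j := [set x | forall d m, D d -> j = pickle (f d, m) ->
  (ball d (r m) `&` M) !=set0 ->
  exists n, (ball d (r m) `&` M) (iter n T x)].
have [|x Mx Gx] := @baire_closed_subset R H M G clM M0.
  move=> j O oO OM.
  (* If [j] codes no ball meeting [M], then [G j] is the whole space and [O] itself serves;
     otherwise transitivity is applied to that ball and [O]. *)
  have [[d [m [Dd jE dM]]]|nex] := pselect (exists d m,
      [/\ D d, j = pickle (f d, m) & (ball d (r m) `&` M) !=set0]); last first.
    exists O; split=> // y [Oy _]; split=> // d m Dd jE dM.
    by case: nex; exists d, m.
  have [||n [_ [[W oW ->] WM Wsub]]] :=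
      trT (ball d (r m) `&` M) (O `&` M) _ dM _ OM.
  - by exists (ball d (r m)) => //; exact: ball_open.
  - by exists O.
  exists W; split=> // y /Wsub[/= Ty [Oy _]]; split=> // d' m' Dd' jE' _.
  (* Injectivity of the coding, and of [f] on [D], shows that [j] codes only this ball. *)
  move: jE'; rewrite jE => /(pcan_inj pickleK)[fd <-].
  by rewrite -(finj d d' _ _ fd) ?inE//; exists n.
exists x; split=> [y []//|y My B /nbhs_ballP[e /= e0 eB]].
have [m me] := complex_harmonic_lt (divr_gt0 e0 (ltr0Sn _ 1)).
(* The base ball around [d] contains [y], so it meets [M]; its radius is below [e / 2], so it lies
   in the [e]-ball around [y]. *)
have [|d [yd Dd]] := dD (ball y (r m)) _ (ball_open _ _).
  by exists y; exact: ballxx.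
have dy : ball d (r m) y by exact: ball_sym.
have [|n [dn Mn]] := Gx _ d m Dd erefl; first by exists y.
exists (iter n T x); split; first by split=> //; exists n.
by apply: eB; apply: (@ball_split _ _ d); apply: le_ball (ltW me) _ _.
Qed.

Lemma bounded_operator_iter_continuous (R : realType) (H : hilbertType R)
    (T : {linear H -> H}) n : bounded_operator T -> continuous (iter n T).
Proof.
move=> [c Tc]; have Tcont : continuous T.
  apply/linear_bounded_continuous/linear_boundedP; exists c%:C%C.
  split=> [|b cb x]; first by rewrite complex_real.
  by apply: le_trans (Tc x) _; rewrite ler_wpM2r// ltW.
elim: n => [|n IHn] x /=; first exact: cvg_id.
by apply: continuous_comp; [exact: IHn|exact: Tcont].
Qed.

Lemma dense_in_rel_open (R : realType) (H : hilbertType R) (M A O : set H) :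
  dense_in M A -> open O -> O `&` M !=set0 -> exists2 a, A a & O a.
Proof.
move=> [_ clA] oO [y [Oy My]].
by have [a [Aa Oa]] := clA y My O (open_nbhs_nbhs (conj oO Oy)); exists a.
Qed.

Lemma subspace_transitive_criterion (R : realType) (H : hilbertType R)
    (T : {linear H -> H}) (M X Y : set H) (n_ : nat -> nat) :
  bounded_operator T -> submod_closed [in M] -> dense_in M X -> dense_in M Y ->
  (forall x, X x -> iter (n_ k) T x @[k --> \oo] --> (0 : H)) ->
  (forall y, Y y -> exists x_ : nat -> H,
     [/\ forall k, M (x_ k),
         x_ k @[k --> \oo] --> (0 : H) &
         iter (n_ k) T (x_ k) @[k --> \oo] --> y]) ->
  (forall k, iter (n_ k) T @` M `<=` M) ->
  subspace_transitive T M.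
Proof.
move=> bT smM dX dY hX hY hM _ _ [P oP ->] U0 [Q oQ ->] V0.
have [y Yy Py] := dense_in_rel_open dY oP U0.
have [x Xx Qx] := dense_in_rel_open dX oQ V0.
have [x_ [Mx_ x_0 Tx_y]] := hY y Yy.
have iterD n a b : iter n T (a + b) = iter n T a + iter n T b.
  by elim: n => //= n ->; rewrite linearD.
have MD a b : M a -> M b -> M (a + b).
  move=> Ma Mb; have [_ /(_ 1 a b)] := smM.
  by rewrite !inE scale1r; apply.
(* The perturbed point [x + x_ k] tends to [x] in [Q], while its image tends to [0 + y] in [P]. *)
have z_x : x + x_ k @[k --> \oo] --> x.
  by rewrite -[X in _ --> X]addr0; apply: cvgD => //; exact: cvg_cst.
have Tz_y : iter (n_ k) T (x + x_ k) @[k --> \oo] --> y.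
  rewrite -[y]add0r (funext (fun k => iterD (n_ k) _ _)).
  by apply: cvgD => //; exact: hX.
have nQ : \forall k \near \oo, Q (x + x_ k).
  by apply: z_x; exact: open_nbhs_nbhs.
have nP : \forall k \near \oo, P (iter (n_ k) T (x + x_ k)).
  by apply: Tz_y; exact: open_nbhs_nbhs.
have [k [Qz Pz]] := filter_ex (filterI nQ nP).
(* Continuity of the iterate makes this set relatively open; invariance of [M] puts its image in [M]
   as well as in [P]. *)
exists (n_ k), ((iter (n_ k) T @^-1` P `&` Q) `&` M); split.
- exists (iter (n_ k) T @^-1` P `&` Q) => //; apply: openI => //.
  apply: open_comp oP => a _; exact: bounded_operator_iter_continuous.
- by exists (x + x_ k); split=> //; apply: MD => //; case: dX => /(_ _ Xx).
- move=> a [[Pa Qa] Ma]; split=> //; split=> //.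
  by apply: (hM k); exists a.
Qed.

Theorem theorem3p6 (R : realType) (H : hilbertType R) (hsep : separable H)
    (T : {linear H -> H}) (hT : bounded_operator T)
    (M : set H) (hM : closed_subspace M) (hM0 : M <> [set 0])
    (X Y : set H) (hX : dense_in M X) (hY : dense_in M Y)
    (n_ : nat -> nat) (n_pos : forall k, (0 < n_ k)%N)
    (n_incr : increasing_seq n_)
    (hi : forall x, X x -> iter (n_ k) T x @[k --> \oo] --> (0 : H))
    (hii : forall y, Y y -> exists x_ : nat -> H,
       [/\ forall k, M (x_ k),
           x_ k @[k --> \oo] --> (0 : H) &
           iter (n_ k) T (x_ k) @[k --> \oo] --> y])
    (hiii : forall k, iter (n_ k) T @` M `<=` M) :
  subspace_transitive T M /\ subspace_hypercyclic T M.
Proof.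
have [clM smM] := hM.
have trT : subspace_transitive T M.
  exact: (subspace_transitive_criterion hT smM hX hY hi hii hiii).
split=> //; apply: subspace_transitive_hypercyclic trT => //.
by exists 0; have [] := smM; rewrite inE.
Qed.
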